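(* Let $T_1>0$, let $n\ge1$ be an integer and let $r$ be real with $0\le r<T_1$. Let $W^m=(w^m_{ij})_{1\le i,j\le4}$ be the matrix $$W^m=\begin{pmatrix} \frac{T_1}{2}+\frac{3r}{2(n+1)} & \frac{T_1}{2} & \frac{T_1}{2}+\frac{3r}{2(n+1)} & \frac{T_1}{2}+\frac{3r}{2(n+2)}\\ \frac{T_1}{2}+\frac{r}{2(n+1)} & \frac{3T_1}{2}-r & \frac{T_1}{2}+\frac{r}{2(n+1)} & \frac{T_1}{2}+\frac{2T_1+r}{2(n+2)}\\ \frac{T_1}{2}+\frac{r}{2(n+1)} & \frac{T_1}{2} & \frac{T_1}{2}+\frac{r}{2(n+1)} & \frac{T_1}{2}+\frac{r}{2(n+2)}\\ 0&0&0&0 \end{pmatrix},$$ and put $$r_c=\left(\frac{2n+2}{2n+5}\right)T_1,\qquad r_s=\left(\frac{2n+2}{2n+3}\right)T_1 .$$ For nonnegative integers $n_1,n_2,n_3,n_4$ with $N=n_1+n_2+n_3+n_4>0$ let $\overline{W_j}=\frac1N\sum_{i=1}^4 n_i\,w^m_{ij}$ for $j=1,2,3,4$. Then: (1) if $r>r_s$, then $w^m_{22}<w^m_{21}<w^m_{24}$; if $r_c<r<r_s$, then $w^m_{21}<w^m_{22}<w^m_{24}$; if $r<r_c$, then $w^m_{21}<w^m_{24}<w^m_{22}$; (2) if $r>r_s$, then $w^m_{i2}\le w^m_{ij}$ for all $i,j\in\{1,2,3,4\}$, and consequently $\overline{W_2}\le\overline{W_j}$ for all $j$, irrespective of the values $n_i$;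 (3) if $r<r_s$ and $$n_2>\frac{r}{(2n+3)(r_s-r)}\,(3n_1+n_3),$$ then $\overline{W_1}\le\overline{W_j}$ for all $j\in\{1,2,3,4\}$.
   Context: The setting is a two-route network with travel times $T_1\le T_2=nT_1+r$. The journeys are $J_1:R_1\to R_1$, $J_2:R_1\to R_2\to R_1$, $J_3:R_2\to R_1\to R_2$, $J_4:R_2\to R_2$. The synchronization rules $S_1,S_2$ use $x_1(k)=\max(T_1+x_1(k-1),\,T_1+T_2+x_1(k-(l+1)))$ with $l\le n$, respectively $l>n$. The rules $S_3,S_4$ use $x_1(k)=\max(T_1+x_1(k-1),\,r+(l+1)T_1+x_1(k-(l+1)))$ with $l\le n$, respectively $l>n$. The entry $w^m_{ij}$ is the total waiting time on journey $J_i$ under rule $S_j$, evaluated at $l=n$ for $j=1,3$ and at $l=n+1$ for $j=4$ (for $j=2$ it does not depend on $l$). The number $n_i$ is the number of passengers taking journey $J_i$, and $\overline{W_j}$ is the average waiting time per passenger under rule $S_j$. For this statement the $w^m_{ij}$ are defined by the displayed matrix; ''minimal'' is meant among $\overline{W_1},\dots,\overline{W_4}$. *)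

(* Defs.v *)
From mathcomp Require Import all_boot all_order all_algebra reals.

Set Implicit Arguments.
Unset Strict Implicit.
Unset Printing Implicit Defensive.

Import Order.TTheory GRing.Theory Num.Theory.
Local Open Scope ring_scope.

(* Journeys J_1, ..., J_4 and rules S_1, ..., S_4 are indexed from 0 by 'I_4:
   the entry w^m_{ij} is [waiting_mx T1 n r (i - 1) (j - 1)].  On 'I_4 the
   numerals 0, 1, 2, 3 denote the elements of Z/4Z with these values. *)
Definition waiting_mx (R : realType) (T1 : R) (n : nat) (r : R) : 'M[R]_4 :=
  \matrix_(i < 4, j < 4)
    nth 0 (nth [::]
      [:: [:: T1 / 2 + 3 * r / (2 * n.+1%:R);
              T1 / 2;
              T1 / 2 + 3 * r / (2 * n.+1%:R);
              T1 / 2 + 3 * r / (2 * n.+2%:R)];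
          [:: T1 / 2 + r / (2 * n.+1%:R);
              3 * T1 / 2 - r;
              T1 / 2 + r / (2 * n.+1%:R);
              T1 / 2 + (2 * T1 + r) / (2 * n.+2%:R)];
          [:: T1 / 2 + r / (2 * n.+1%:R);
              T1 / 2;
              T1 / 2 + r / (2 * n.+1%:R);
              T1 / 2 + r / (2 * n.+2%:R)];
          [:: 0; 0; 0; 0]] i) j.

Definition r_c (R : realType) (T1 : R) (n : nat) : R :=
  (2 * n + 2)%:R / (2 * n + 5)%:R * T1.

Definition r_s (R : realType) (T1 : R) (n : nat) : R :=
  (2 * n + 2)%:R / (2 * n + 3)%:R * T1.

Definition passengers (p : 'I_4 -> nat) : nat := (\sum_(i < 4) p i)%N.

Definition mean_waiting (R : realType) (T1 : R) (n : nat) (r : R)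
    (p : 'I_4 -> nat) (j : 'I_4) : R :=
  (passengers p)%:R^-1 * \sum_(i < 4) (p i)%:R * waiting_mx T1 n r i j.

(* Main.v *)
Require Import Defs.
From mathcomp Require Import all_boot all_order all_algebra reals.
From mathcomp Require Import ring lra.

Import Order.TTheory GRing.Theory Num.Theory.
Local Open Scope ring_scope.

(** Every claim is a sign condition on a difference of two columns of the
    matrix, and over common denominators these differences factor so that the
    thresholds become visible.  In the row of journey J_2,

      w_22 - w_21 = (2n+3) (r_s - r) / (2(n+1)),
      w_22 - w_24 = (2n+5) (r_c - r) / (2(n+2)),
      w_24 - w_21 = (2(n+1) T_1 - r) / (2(n+1)(n+2)) > 0,

    which gives the three orderings.  In the other rows the entry of S_2 is
    T_1 / 2 or 0, hence always smallest; so S_2 is minimal in every row as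
    soon as it is in row J_2, that is when r > r_s, and the averages follow
    since the weights are nonnegative.

    When r < r_s, only journey J_2 speaks for S_1 against S_2 and S_4, and
    the passengers of J_1 and J_3 enter only through 3 n_1 + n_3.  Summed
    over all passengers,

      sum_2 - sum_1 = ((2n+3)(r_s - r) n_2 - r (3 n_1 + n_3)) / (2(n+1)),
      sum_4 - sum_1 = ((2(n+1) T_1 - r) n_2 - r (3 n_1 + n_3))
                                                       / (2(n+1)(n+2)).

    The hypothesis on n_2 makes the first numerator positive.  As
    (2n+3)(r_s - r) = 2(n+1) T_1 - (2n+3) r <= 2(n+1) T_1 - r, it makes the
    second one positive too.  Rules S_1 and S_3 have equal columns. *)

Lemma big_I4 (V : nmodType) (F : 'I_4 -> V) :
  \sum_(i < 4) F i = F 0 + F 1 + F 2 + F 3.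
Proof.
rewrite !big_ord_recl big_ord0 addr0 !addrA.
by congr (F _ + F _ + F _ + F _); apply: val_inj.
Qed.

Lemma I4_cases (j : 'I_4) : [\/ j = 0, j = 1, j = 2 | j = 3].
Proof.
by case: j => [[|[|[|[|//]]]] lt_j4];
  [apply: Or41 | apply: Or42 | apply: Or43 | apply: Or44]; apply: val_inj.
Qed.

(** Multiplying by 2n+3 clears the denominator of r_s, so the numerators in
    which r_s appears can be compared with 2(n+1) T_1 - r. *)
Lemma r_sE (R : realType) (T1 : R) (n : nat) (r : R) :
  (2 * n + 3)%:R * (r_s T1 n - r) = 2 * n.+1%:R * T1 - (2 * n + 3)%:R * r.
Proof.
have n_ge0 : 0 <= n%:R :> R by exact: ler0n.
by rewrite /r_s; field; rewrite lt0r_neq0 //; lra.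
Qed.

Lemma w22_sub_w21 (R : realType) (T1 : R) (n : nat) (r : R) :
  waiting_mx T1 n r 1 1 - waiting_mx T1 n r 1 0
    = (2 * n + 3)%:R * (r_s T1 n - r) / (2 * n.+1%:R).
Proof.
have n_ge0 : 0 <= n%:R :> R by exact: ler0n.
rewrite r_sE !mxE /=; field; rewrite lt0r_neq0 //; lra.
Qed.

Lemma w22_sub_w24 (R : realType) (T1 : R) (n : nat) (r : R) :
  waiting_mx T1 n r 1 1 - waiting_mx T1 n r 1 3
    = (2 * n + 5)%:R * (r_c T1 n - r) / (2 * n.+2%:R).
Proof.
have n_ge0 : 0 <= n%:R :> R by exact: ler0n.
by rewrite /r_c !mxE /=; field; rewrite !lt0r_neq0 //; lra.
Qed.

Lemma w24_sub_w21 (R : realType) (T1 : R) (n : nat) (r : R) :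
  waiting_mx T1 n r 1 3 - waiting_mx T1 n r 1 0
    = (2 * n.+1%:R * T1 - r) / (2 * n.+1%:R * n.+2%:R).
Proof.
have n_ge0 : 0 <= n%:R :> R by exact: ler0n.
by rewrite !mxE /=; field; rewrite !lt0r_neq0 //; lra.
Qed.

Lemma waiting_rule3_eq_rule1 (R : realType) (T1 : R) (n : nat) (r : R)
    (i : 'I_4) :
  waiting_mx T1 n r i 2 = waiting_mx T1 n r i 0.
Proof. by case: (I4_cases i) => ->; rewrite !mxE. Qed.

Lemma w21_lt_w24 (R : realType) (T1 : R) (n : nat) (r : R) :
  0 < T1 -> r < T1 -> waiting_mx T1 n r 1 0 < waiting_mx T1 n r 1 3.
Proof.
move=> T1_gt0 r_lt; rewrite -subr_gt0 w24_sub_w21 divr_gt0 ?mulr_gt0 //.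
have n_ge0 : 0 <= n%:R :> R by exact: ler0n.
by nra.
Qed.

Lemma w22_lt_w21 (R : realType) (T1 : R) (n : nat) (r : R) :
  (waiting_mx T1 n r 1 1 < waiting_mx T1 n r 1 0) = (r_s T1 n < r).
Proof.
rewrite -subr_lt0 w22_sub_w21 pmulr_llt0; last by rewrite invr_gt0 mulr_gt0.
by rewrite pmulr_rlt0 ?subr_lt0 // ltr0n addnS.
Qed.

Lemma w21_lt_w22 (R : realType) (T1 : R) (n : nat) (r : R) :
  (waiting_mx T1 n r 1 0 < waiting_mx T1 n r 1 1) = (r < r_s T1 n).
Proof.
rewrite -subr_gt0 w22_sub_w21 pmulr_lgt0; last by rewrite invr_gt0 mulr_gt0.
by rewrite pmulr_rgt0 ?subr_gt0 // ltr0n addnS.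
Qed.

Lemma w22_lt_w24 (R : realType) (T1 : R) (n : nat) (r : R) :
  (waiting_mx T1 n r 1 1 < waiting_mx T1 n r 1 3) = (r_c T1 n < r).
Proof.
rewrite -subr_lt0 w22_sub_w24 pmulr_llt0; last by rewrite invr_gt0 mulr_gt0.
by rewrite pmulr_rlt0 ?subr_lt0 // ltr0n addnS.
Qed.

Lemma w24_lt_w22 (R : realType) (T1 : R) (n : nat) (r : R) :
  (waiting_mx T1 n r 1 3 < waiting_mx T1 n r 1 1) = (r < r_c T1 n).
Proof.
rewrite -subr_gt0 w22_sub_w24 pmulr_lgt0; last by rewrite invr_gt0 mulr_gt0.
by rewrite pmulr_rgt0 ?subr_gt0 // ltr0n addnS.
Qed.

(** In row J_2 this is w_22 < w_21 < w_24.  In rows J_1 and J_3 the other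
    rules add to T_1 / 2 a nonnegative multiple of r, and row J_4 is zero. *)
Lemma rule2_min (R : realType) (T1 : R) (n : nat) (r : R) (i j : 'I_4) :
  0 < T1 -> 0 <= r -> r < T1 -> r_s T1 n < r ->
  waiting_mx T1 n r i 1 <= waiting_mx T1 n r i j.
Proof.
move=> T1_gt0 r_ge0 r_lt rs_lt.
have w22_lt : waiting_mx T1 n r 1 1 < waiting_mx T1 n r 1 0.
  by rewrite w22_lt_w21.
have w21_lt := w21_lt_w24 _ _ n _ T1_gt0 r_lt.
have q_ge0 k : 0 <= r / (2 * k.+1%:R) by rewrite divr_ge0 ?mulr_ge0.
have q3_ge0 k : 0 <= 3 * r / (2 * k.+1%:R) by rewrite divr_ge0 ?mulr_ge0.
case: (I4_cases i) => ->.
- by case: (I4_cases j) => ->; rewrite !mxE //= lerDl.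
- by case: (I4_cases j) => ->; rewrite ?waiting_rule3_eq_rule1 ?lexx ?ltW //;
    rewrite (lt_trans w22_lt).
- by case: (I4_cases j) => ->; rewrite !mxE //= lerDl.
- by case: (I4_cases j) => ->; rewrite !mxE.
Qed.

Lemma ler_mean_waiting (R : realType) (T1 : R) (n : nat) (r : R)
    (p : 'I_4 -> nat) (j k : 'I_4) :
  \sum_(i < 4) (p i)%:R * waiting_mx T1 n r i j
    <= \sum_(i < 4) (p i)%:R * waiting_mx T1 n r i k ->
  mean_waiting T1 n r p j <= mean_waiting T1 n r p k.
Proof. by move=> le_sum; rewrite ler_wpM2l // invr_ge0 ler0n. Qed.

Lemma sum2_sub_sum1 (R : realType) (T1 : R) (n : nat) (r : R)
    (p : 'I_4 -> nat) :
  \sum_(i < 4) (p i)%:R * waiting_mx T1 n r i 1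
    - \sum_(i < 4) (p i)%:R * waiting_mx T1 n r i 0
  = ((2 * n + 3)%:R * (r_s T1 n - r) * (p 1)%:R - r * (3 * p 0 + p 2)%:R)
      / (2 * n.+1%:R).
Proof.
have n_ge0 : 0 <= n%:R :> R by exact: ler0n.
by rewrite r_sE !big_I4 !mxE /=; field; rewrite lt0r_neq0 //; lra.
Qed.

Lemma sum4_sub_sum1 (R : realType) (T1 : R) (n : nat) (r : R)
    (p : 'I_4 -> nat) :
  \sum_(i < 4) (p i)%:R * waiting_mx T1 n r i 3
    - \sum_(i < 4) (p i)%:R * waiting_mx T1 n r i 0
  = ((2 * n.+1%:R * T1 - r) * (p 1)%:R - r * (3 * p 0 + p 2)%:R)
      / (2 * n.+1%:R * n.+2%:R).
Proof.
have n_ge0 : 0 <= n%:R :> R by exact: ler0n.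
by rewrite !big_I4 !mxE /=; field; rewrite !lt0r_neq0 //; lra.
Qed.

(** The bound on n_2 is exactly the condition sum_1 < sum_2.  It also gives
    sum_1 < sum_4, because in the numerators of the two differences the
    passengers of J_1 and J_3 have the same coefficients, while the
    coefficient of n_2 is at least as large for S_4 as for S_2. *)
Lemma rule1_mean_min (R : realType) (T1 : R) (n : nat) (r : R)
    (p : 'I_4 -> nat) (j : 'I_4) :
  0 <= r -> r < r_s T1 n ->
  r / ((2 * n + 3)%:R * (r_s T1 n - r)) * (3 * p 0 + p 2)%:R < (p 1)%:R ->
  mean_waiting T1 n r p 0 <= mean_waiting T1 n r p j.
Proof.
move=> r_ge0 r_lt n2_gt; apply: ler_mean_waiting.
have d_gt0 : 0 < (2 * n + 3)%:R * (r_s T1 n - r).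
  by rewrite mulr_gt0 ?subr_gt0 // ltr0n addnS.
have num2_gt0 : r * (3 * p 0 + p 2)%:R
    < (2 * n + 3)%:R * (r_s T1 n - r) * (p 1)%:R.
  by move: n2_gt; rewrite mulrAC ltr_pdivrMr // [X in _ < X]mulrC.
(* This compares the coefficients of n_2 for S_2 and for S_4. *)
have d_le : (2 * n + 3)%:R * (r_s T1 n - r) <= 2 * n.+1%:R * T1 - r.
  by rewrite r_sE lerD2l lerN2 ler_peMl // ler1n addnS.
case: (I4_cases j) => ->.
- by [].
- by rewrite -subr_ge0 sum2_sub_sum1 divr_ge0 ?mulr_ge0 // subr_ge0 ltW.
- by under [leRHS]eq_bigr => i _ do rewrite waiting_rule3_eq_rule1.
- rewrite -subr_ge0 sum4_sub_sum1 divr_ge0 ?mulr_ge0 // subr_ge0.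
  by rewrite (le_trans (ltW num2_gt0)) // ler_wpM2r.
Qed.

Theorem mainTheorem4 (R : realType) (T1 : R) (n : nat) (r : R)
    (T1_gt0 : 0 < T1) (n_ge1 : (1 <= n)%N) (r_ge0 : 0 <= r) (r_lt : r < T1) :
  let w := waiting_mx T1 n r in
  let rc := r_c T1 n in
  let rs := r_s T1 n in
  let Wbar := mean_waiting T1 n r in
  [/\ [/\ rs < r -> w 1 1 < w 1 0 /\ w 1 0 < w 1 3,
          rc < r -> r < rs -> w 1 0 < w 1 1 /\ w 1 1 < w 1 3
        & r < rc -> w 1 0 < w 1 3 /\ w 1 3 < w 1 1],
      rs < r ->
        (forall i j : 'I_4, w i 1 <= w i j) /\
        (forall p : 'I_4 -> nat, (0 < passengers p)%N ->
           forall j : 'I_4, Wbar p 1 <= Wbar p j)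
    & forall p : 'I_4 -> nat, (0 < passengers p)%N ->
        r < rs ->
        r / ((2 * n + 3)%:R * (rs - r)) * (3 * p 0 + p 2)%:R < (p 1)%:R ->
        forall j : 'I_4, Wbar p 0 <= Wbar p j].
Proof.
move=> w rc rs Wbar; split.
- by split; rewrite /w ?w22_lt_w21 ?w21_lt_w22 ?w22_lt_w24 ?w24_lt_w22;
    split=> //; exact: w21_lt_w24.
- move=> rs_lt.
  have w_min i j : w i 1 <= w i j by exact: rule2_min.
  split=> // p _ j; apply: ler_mean_waiting.
  by apply: ler_sum => i _; rewrite ler_wpM2l.
- by move=> p _ r_lt_rs n2_gt j; exact: rule1_mean_min.
Qed.
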